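(* Let $r_1,\dots,r_4\in\mathbb{C}$ and $s_1,\dots,s_6\in\mathbb{C}\setminus\{0\}$. Let $\mathbb{B}=\mathbb{B}(r_1,\dots,r_4;s_1,\dots,s_6)$, acting as a bounded linear operator on $c_0$. Then $$\{r_1,r_2,r_3,r_4\}\subseteq III_1\sigma(\mathbb{B},c_0).$$
   Context: $c_0$ is the Banach space of complex sequences $x=(x_k)_{k\ge 0}$ converging to $0$, with the supremum norm. For an integer $a$ and $n\in\mathbb{N}$, $a\,(\mathrm{mod}\ n)$ denotes the remainder in $\{0,\dots,n-1\}$ of $a$ modulo $n$. The matrix $\mathbb{B}(r_1,\dots,r_4;s_1,\dots,s_6)=(b_{ij})_{i,j\ge 0}$ is the infinite lower triangular matrix with $b_{ij}=r_{j(\mathrm{mod}\ 4)+1}$ if $i=j$, $b_{ij}=s_{j(\mathrm{mod}\ 6)+1}$ if $i=j+1$, and $b_{ij}=0$ otherwise; it acts on sequences by $(\mathbb{B}x)_k=\sum_{j}b_{kj}x_j$. In Goldberg's classification, $III_1\sigma(T,X)$ is the set of $\lambda\in\mathbb{C}$ such that the range of $T-\lambda I$ is not dense in $X$, and $T-\lambda I$ is injective with bounded inverse $(T-\lambda I)^{-1}$ on its range. *)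

(* Defs.v *)
From HB Require Import structures.
From mathcomp Require Import all_boot all_order all_algebra.
From mathcomp Require Import complex.
From mathcomp Require Import all_classical all_reals all_analysis.
Set Implicit Arguments.
Unset Strict Implicit.
Unset Printing Implicit Defensive.
Import Order.TTheory GRing.Theory Num.Theory.
Import numFieldNormedType.Exports.
Local Open Scope classical_set_scope.
Local Open Scope ring_scope.
Local Open Scope complex_scope.

(* The topology of the modulus. *)
HB.instance Definition _ (R : rcfType) := NormedModule.copy R[i] R[i]^o.

(* T is injective with a left inverse S on its range; the values of S outside
   the range are irrelevant. *)
Definition has_bounded_inverse_on_range (K : numFieldType) (X : normedModType K)
    (T : X -> X) :=
  exists S : X -> X, cancel T S /\
    exists M : K, forall y, range T y -> `|S y| <= M * `|y|.

Definition III1_spectrum (K : numFieldType) (X : normedModType K)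
    (T : {linear X -> X}) : set K :=
  [set l | let Tl := fun x : X => T x - l *: x in
    [/\ ~ dense (range Tl), injective Tl & has_bounded_inverse_on_range Tl]].

Section c0.
Variable R : realType.
Implicit Types (u v : nat -> R[i]).

(* In R[i] the norm `|z| is itself a complex number, with zero imaginary part. *)
Definition modulus (z : R[i]) : R := complex.Re `|z|.

Lemma modulusE z : (modulus z)%:C = `|z|.
Proof. by rewrite /modulus RRe_real// normr_real. Qed.

Lemma modulus_ge0 z : 0 <= modulus z.
Proof. by rewrite -lecR modulusE normr_ge0. Qed.

Definition c0_pred : {pred nat -> R[i]} := fun u => `[< u @ \oo --> 0 >].

Lemma c0_submod_closed : submod_closed c0_pred.
Proof.
split=> [|a u v /asboolP uc /asboolP vc]; apply/asboolP; first exact: cvg_cst.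
have h : (fun k => a * u k + v k) @ \oo --> a * 0 + 0.
  by apply: cvgD vc; apply: cvgM uc; exact: cvg_cst.
by rewrite mulr0 addr0 in h.
Qed.

HB.instance Definition _ :=
  GRing.isSubmodClosed.Build _ _ c0_pred c0_submod_closed.

Record c0 := C0 { c0_seq :> nat -> R[i]; c0P : c0_seq \in c0_pred }.

HB.instance Definition _ := [isSub for c0_seq].
HB.instance Definition _ := [Choice of c0 by <:].
HB.instance Definition _ := [SubChoice_isSubLmodule of c0 by <:].

Lemma c0_cvg (x : c0) : x @ \oo --> 0.
Proof. exact/asboolP/c0P. Qed.

Definition c0_norm_set (x : c0) : set R := range (fun k => modulus (x k)).

Lemma c0_has_sup (x : c0) : has_sup (c0_norm_set x).
Proof.
split; first by exists (modulus (x 0%N)); exists 0%N.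
have xb : bounded_fun (x : nat -> R[i]).
  by apply: cvg_seq_bounded; apply/cvg_ex; exists 0; exact: c0_cvg.
have [M [Mr xM]] := pinfty_ex_gt0 xb.
exists (complex.Re M) => _ [k _ <-].
by rewrite -lecR modulusE RRe_real ?gtr0_real//; exact: xM.
Qed.

Definition c0_norm (x : c0) : R[i] := (sup (c0_norm_set x))%:C.

Lemma c0_seqD (x y : c0) k : (x + y) k = x k + y k. Proof. by []. Qed.

Lemma c0_seqZ a (x : c0) k : (a *: x) k = a * x k. Proof. by []. Qed.

Lemma c0_ext (x y : c0) : (forall k, x k = y k) -> x = y.
Proof. by move=> xy; apply/val_inj/funext. Qed.

Lemma c0_norm_ub (x : c0) k : `|x k| <= c0_norm x.
Proof.
rewrite -modulusE lecR; apply: ub_le_sup; last by exists k.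
by have [] := c0_has_sup x.
Qed.

Lemma c0_norm_le (x : c0) (M : R[i]) : (forall k, `|x k| <= M) -> c0_norm x <= M.
Proof.
move=> h; have Mr : M \is Num.real by rewrite ger0_real// (le_trans _ (h 0%N)).
rewrite -(RRe_real Mr) lecR; apply: ge_sup; first by have [] := c0_has_sup x.
by move=> _ [k _ <-]; rewrite -lecR modulusE RRe_real.
Qed.

Lemma c0_norm_ge0 x : 0 <= c0_norm x.
Proof. exact: le_trans (c0_norm_ub x 0). Qed.

Lemma c0_normD x y : c0_norm (x + y) <= c0_norm x + c0_norm y.
Proof.
apply: c0_norm_le => k; rewrite c0_seqD (le_trans (ler_normD _ _))//.
by rewrite lerD// c0_norm_ub.
Qed.

Lemma c0_normZ_le a x : c0_norm (a *: x) <= `|a| * c0_norm x.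
Proof.
by apply: c0_norm_le => k; rewrite c0_seqZ normrM ler_wpM2l// c0_norm_ub.
Qed.

Lemma c0_normZ a x : c0_norm (a *: x) = `|a| * c0_norm x.
Proof.
apply/eqP; rewrite eq_le c0_normZ_le/=.
have [->|a0] := eqVneq a 0; first by rewrite normr0 mul0r c0_norm_ge0.
rewrite -ler_pdivlMl ?normr_gt0// -normfV.
by rewrite -[leLHS](congr1 c0_norm (scalerK a0 x)) c0_normZ_le.
Qed.

Lemma c0_norm0_eq0 x : c0_norm x = 0 -> x = 0.
Proof.
move=> x0; apply: c0_ext => k; apply/eqP.
by rewrite -normr_le0 -x0 c0_norm_ub.
Qed.

HB.instance Definition _ :=
  Lmodule_isNormed.Build R[i] c0 c0_normD c0_normZ c0_norm0_eq0.

Definition matrix_act (A : nat -> nat -> R[i]) (u : nat -> R[i]) : nat -> R[i] :=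
  fun k => limn (series (fun j => A k j * u j)).

Variables (r : 'I_4 -> R[i]) (s : 'I_6 -> R[i]).

(* r and s are indexed from 0: r_{q+1} and s_{q+1} are r q and s q. *)
Definition B_entry (i j : nat) : R[i] :=
  if i == j then r (inord (j %% 4))
  else if i == j.+1 then s (inord (j %% 6))
  else 0.

Lemma B_entry0 i j : (i < j)%N -> B_entry i j = 0.
Proof.
by move=> ij; rewrite /B_entry (ltn_eqF ij) (ltn_eqF (ltnW ij : (i < j.+1)%N)).
Qed.

Lemma B_actE u k : matrix_act B_entry u k = \sum_(j < k.+1) B_entry k j * u j.
Proof.
apply: cvg_lim => //; apply: cvg_near_cst; near=> n.
rewrite /series/= -(big_mkord xpredT (fun j => B_entry k j * u j)).
have kn : (k.+1 <= n)%N by near: n; exact: nbhs_infty_ge.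
rewrite (big_cat_nat (leq0n _) kn)//= [X in _ + X]big_nat_cond [X in _ + X]big1 ?addr0//.
by move=> j /andP[/andP[kj _] _]; rewrite B_entry0// mul0r.
Unshelve. all: by end_near. Qed.

Lemma B_act0 u : matrix_act B_entry u 0 = r (inord 0) * u 0%N.
Proof. by rewrite B_actE big_ord1. Qed.

Lemma B_actS u k : matrix_act B_entry u k.+1 =
  s (inord (k %% 6)) * u k + r (inord (k.+1 %% 4)) * u k.+1.
Proof.
rewrite B_actE 2!big_ord_recr/= big1 ?add0r => [|j _].
  by rewrite /B_entry !eqxx gtn_eqF.
rewrite /B_entry gtn_eqF ?(ltn_trans (ltn_ord j))//.
by rewrite eqSS gtn_eqF// mul0r.
Qed.

Definition B_bound : R[i] := (\sum_q `|r q|) + \sum_q `|s q|.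

Lemma B_act_bound u k (M : R[i]) : (forall j, (k <= j.+1)%N -> `|u j| <= M) ->
  `|matrix_act B_entry u k| <= B_bound * M.
Proof.
move=> uM; have M0 : 0 <= M by exact: le_trans (uM k _).
have rle q : `|r q| <= \sum_q `|r q|.
  by rewrite (bigD1 q)//= lerDl sumr_ge0.
have sle q : `|s q| <= \sum_q `|s q|.
  by rewrite (bigD1 q)//= lerDl sumr_ge0.
rewrite /B_bound mulrDl; case: k uM => [|k] uM.
  rewrite B_act0 normrM (le_trans (ler_pM _ _ (rle _) (uM 0%N _)))//.
  by rewrite lerDl mulr_ge0// sumr_ge0.
rewrite B_actS addrC (le_trans (ler_normD _ _))// !normrM.
by apply: lerD; apply: ler_pM => //; apply: uM.
Qed.

Lemma B_act_c0 (x : c0) : matrix_act B_entry x \in c0_pred.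
Proof.
have B0 : 0 <= B_bound by rewrite addr_ge0// sumr_ge0.
apply/asboolP/cvgr0Pnorm_le => e e0.
have d0 : 0 < e / (B_bound + 1) by rewrite divr_gt0// ltr_wpDl.
have [N _ xN] := (cvgr0Pnorm_le (x : nat -> R[i])).1 (@c0_cvg x) _ d0.
exists N.+1 => // k /= Nk.
apply: (@le_trans _ _ (B_bound * (e / (B_bound + 1)))).
  by apply: B_act_bound => j kj; apply: xN => /=; exact: (leq_trans Nk kj).
rewrite mulrCA ger_pMr// ler_pdivrMr ?ltr_wpDl// mul1r.
by rewrite lerDl.
Qed.

Definition B_op (x : c0) : c0 := C0 (B_act_c0 x).

Lemma B_op_linear : linear B_op.
Proof.
move=> a x y; apply: c0_ext => k.
rewrite c0_seqD c0_seqZ /= !B_actE mulr_sumr -big_split/=.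
by apply: eq_bigr => j _; rewrite [LHS]mulrDr [X in X + _ = _]mulrCA.
Qed.

HB.instance Definition _ := GRing.isLinear.Build R[i] c0 c0 *:%R B_op B_op_linear.

Lemma B_op_bound x : `|B_op x| <= B_bound * `|x|.
Proof.
apply: c0_norm_le => k; apply: B_act_bound => j _.
exact: c0_norm_ub.
Qed.

Lemma B_op_continuous : continuous B_op.
Proof.
apply: bounded_linear_continuous; apply/linear_boundedP.
near=> M => x; rewrite (le_trans (B_op_bound x))// ler_wpM2r//.
near: M; apply: nbhs_pinfty_ge.
by rewrite ger0_real// addr_ge0// sumr_ge0.
Unshelve. all: by end_near. Qed.

End c0.

(* Main.v *)
(** Let [l = r q], and let [d k] be the [k]-th diagonal entry of [B - l], so
    that [d k = 0] whenever [k = q] mod 4.  Such a zero decouples [B - l] twice.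
    Reading [(B x - l x) (j+1) = s j * x j + d (j+1) * x (j+1)] backwards from
    the next zero of [d] recovers [x j] in at most four steps, so [B - l] is
    bounded below.  Reading forwards, the weights [phi 0 = 1],
    [phi (k+1) = - phi k * d k / s k] make [\sum_(k <= n) phi k * y k] telescope
    to [phi n * d n * x n] on [y = B x - l x]; for [n = q] this is a nonzero
    bounded functional vanishing on the range, which therefore is not dense. *)
From HB Require Import structures.
Require Import Defs.
From mathcomp Require Import all_boot all_order all_algebra.
From mathcomp Require Import complex.
From mathcomp Require Import all_classical all_reals all_analysis.
Import Order.TTheory GRing.Theory Num.Theory.
Import numFieldNormedType.Exports.
Local Open Scope classical_set_scope.
Local Open Scope ring_scope.
Local Open Scope complex_scope.

Section bounded_below.
Context {K : numFieldType} {X : normedModType K}.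

Lemma bounded_below_inj (T : {linear X -> X}) (M : K) :
  (forall x, `|x| <= M * `|T x|) -> injective T.
Proof.
move=> TM x y Txy; apply/eqP; rewrite -subr_eq0 -normr_le0.
by rewrite (le_trans (TM _))// linearB Txy subrr normr0 mulr0.
Qed.

Lemma bounded_inverse_on_range (T : X -> X) (M : K) :
  injective T -> (forall x, `|x| <= M * `|T x|) ->
  has_bounded_inverse_on_range T.
Proof.
(* [S] picks a preimage, with the irrelevant default 0 off the range. *)
move=> Tinj TM; pose S y := xget 0 [set x | T x = y].
have TK : cancel T S.
  by move=> x; apply: Tinj; apply: (@xgetPex _ 0 [set z | T z = T x]); exists x.
by exists S; split=> //; exists M => _ [x _ <-]; rewrite TK.
Qed.

End bounded_below.

Section bidiagonal.
Context {K : numFieldType}.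
Implicit Types d s x y : nat -> K.

(** Solving the recurrence for [x j] turns a bound [C * N] on [x j.+1] into [m * (1 + D * C) * N];
    at a zero of [d] the recursion starts from [x j = y j.+1 / s j], whence the initial constant
    [m]. *)
Lemma bidiagonal_backward_bound d s x y (m D N : K) :
  (forall j, s j != 0) -> (forall j, `|(s j)^-1| <= m) ->
  (forall j, `|d j| <= D) -> (forall j, `|y j| <= N) ->
  (forall j, y j.+1 = s j * x j + d j.+1 * x j.+1) ->
  forall n j, d (j + n).+1 = 0 ->
  `|x j| <= iter n (fun C => m * (1 + D * C)) m * N.
Proof.
move=> s0 sm dD yN yE.
have xE j : x j = (s j)^-1 * (y j.+1 - d j.+1 * x j.+1).
  by rewrite yE addrK mulKf.
elim=> [|n IHn] j dj.
  rewrite xE; rewrite addn0 in dj; rewrite dj mul0r subr0 normrM.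
  exact: ler_pM.
rewrite xE normrM /= -mulrA; apply: ler_pM => //.
rewrite mulrDl mul1r -mulrA (le_trans (ler_normB _ _))// lerD// normrM.
by apply: ler_pM => //; apply: IHn; rewrite addSnnS.
Qed.

Definition annihilator d s : nat -> K :=
  fix phi k := if k is k'.+1 then - (phi k' * d k' / s k') else 1.

Lemma annihilator_sum d s x y :
  (forall j, s j != 0) -> y 0%N = d 0%N * x 0%N ->
  (forall j, y j.+1 = s j * x j + d j.+1 * x j.+1) ->
  forall n, \sum_(k < n.+1) annihilator d s k * y k
            = annihilator d s n * d n * x n.
Proof.
move=> s0 y0 yE; elim=> [|n IHn]; first by rewrite big_ord1 y0 mulrA.
rewrite big_ord_recr /= {}IHn yE mulrDr !mulrA addrA [- _ * s n]mulNr divfK//.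
by rewrite mulNr subrr add0r.
Qed.

End bidiagonal.

Section c0_unit.
Variable R : realType.

Lemma c0_unit0_subproof : (fun k => (k == 0%N)%:R : R[i]) \in @c0_pred R.
Proof.
apply/asboolP; apply: cvg_near_cst; exists 1%N => // k /= k0.
by rewrite gtn_eqF.
Qed.

Definition c0_unit0 : c0 R := C0 c0_unit0_subproof.

(** The functional with weights [phi] is 1 at [c0_unit0] and has norm at most [a], so its kernel
    misses the ball of radius [a^-1] around [c0_unit0]. *)
Lemma not_dense_annihilated (phi : nat -> R[i]) n (A : set (c0 R)) :
  phi 0%N = 1 ->
  (forall y, A y -> \sum_(k < n.+1) phi k * y k = 0) -> ~ dense A.
Proof.
move=> phi0 phiA Ad; pose a : R[i] := \sum_(k < n.+1) `|phi k|.
have a0 : 0 < a.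
  by rewrite /a big_ord_recl /= phi0 normr1 ltr_pwDl// sumr_ge0.
have av0 : 0 < a^-1 by rewrite invr_gt0.
have [y [yb /phiA yA]] : ball c0_unit0 a^-1 `&` A !=set0.
  apply: Ad; first by exists c0_unit0; exact: ballxx.
  exact: ball_open.
have: 1 <= a * `|c0_unit0 - y|.
  have -> : 1 = `|\sum_(k < n.+1) phi k * (c0_unit0 - y) k|.
    under eq_bigr => k _ do rewrite [(c0_unit0 - y) k]/(c0_unit0 k - y k) mulrBr.
    rewrite sumrB yA subr0 big_ord_recl /= phi0 mulr1 big1 ?addr0 ?normr1//.
    by move=> k _; rewrite mulr0.
  rewrite mulr_suml (le_trans (ler_norm_sum _ _ _))// ler_sum// => k _.
  by rewrite normrM ler_wpM2l// c0_norm_ub.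
(* The order on [R[i]] is partial: negating [<=] needs both sides real. *)
apply/negP; rewrite -real_ltNge ?realM ?normr_real ?gtr0_real//.
by rewrite mulrC -ltr_pdivlMr// div1r; move: yb; rewrite -ball_normE.
Qed.

End c0_unit.

Theorem theorem4p7 (R : realType) (r : 'I_4 -> R[i]) (s : 'I_6 -> R[i])
    (s_neq0 : forall q, s q != 0) :
  range r `<=` III1_spectrum (@B_op R r s).
Proof.
move=> _ [q _ <-] Tl.
pose d k := r (inord (k %% 4)) - r q; pose t k := s (inord (k %% 6)).
have t0 k : t k != 0 by exact: s_neq0.
have d0 k : (k %% 4)%N = q -> d k = 0.
  by move=> kq; rewrite /d kq inord_val subrr.
have Tl0 x : Tl x 0%N = d 0%N * x 0%N.
  by rewrite [LHS]/(_ - r q * x 0%N) /= B_act0 mulrBl.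
have TlS x j : Tl x j.+1 = t j * x j + d j.+1 * x j.+1.
  by rewrite [LHS]/(_ - r q * x j.+1) /= B_actS mulrBl addrA.
pose m : R[i] := \sum_p `|(s p)^-1|; pose D : R[i] := \sum_p `|r p - r q|.
have tm k : `|(t k)^-1| <= m.
  by rewrite /m (bigD1 (inord (k %% 6)))//= lerDl sumr_ge0.
have dD k : `|d k| <= D.
  by rewrite /D (bigD1 (inord (k %% 4)))//= lerDl sumr_ge0.
pose C n := iter n (fun C => m * (1 + D * C)) m.
have m0 : 0 <= m by rewrite sumr_ge0.
have D0 : 0 <= D by rewrite sumr_ge0.
have C_ge0 n : 0 <= C n.
  by elim: n => //= n IHn; rewrite mulr_ge0 ?addr_ge0 ?mulr_ge0.
(* The number of backward steps depends on [j]; summing the four possible constants makes the bound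
   uniform. *)
have TlM x : `|x| <= (\sum_(n < 4) C n) * `|Tl x|.
  apply: c0_norm_le => j.
  have [n nj] : exists n : 'I_4, ((j + n).+1 %% 4)%N = q.
    (* This is [q - j.+1] modulo 4, since 3 is -1 there. *)
    exists (inord ((q + 3 * j.+1) %% 4)); rewrite inordK ?ltn_pmod//.
    rewrite -addSn modnDmr addnCA -mulSn addnC mulnC modnMDl.
    by rewrite modn_small.
  have := @bidiagonal_backward_bound _ d t x (Tl x) m D `|Tl x| t0 tm dD
    (fun k => c0_norm_ub _ k) (TlS x) n j (d0 _ nj).
  move=> /le_trans; apply; rewrite ler_wpM2r//.
  by rewrite (bigD1 n)//= lerDl sumr_ge0.
have Tl_lin : linear Tl.
  move=> a x y; rewrite /Tl linearP scalerDr scalerBr !scalerA mulrC.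
  by rewrite opprD addrACA.
pose TlL : {linear c0 R -> c0 R} :=
  HB.pack Tl (GRing.isLinear.Build R[i] (c0 R) (c0 R) *:%R Tl Tl_lin).
have Tl_inj : injective Tl := @bounded_below_inj _ _ TlL _ TlM.
split=> //; last exact: bounded_inverse_on_range TlM.
(* Stopping at index [q < 4], the telescoped sum carries the factor [d q = 0]. *)
apply: (@not_dense_annihilated _ (annihilator d t) q) => // _ [x _ <-].
rewrite (@annihilator_sum _ d t x (Tl x) t0 (Tl0 x) (TlS x)) d0 ?modn_small//.
by rewrite mulr0 mul0r.
Qed.
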